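(* Every rectifiable simple closed curve $\mathcal{C}\subset\mathbb{S}^2$ of length $L\ge2\pi$ has covering radius $R\ge\vartheta$, where $\vartheta\in(0,\pi/2]$ is determined by $\sin\vartheta=2\pi/L$. Moreover, for a rectifiable simple closed curve $\mathcal{C}\subset\mathbb{S}^2$ of any length $L$, if $T_\theta(\mathcal{C})=\mathbb{S}^2$ for some $\theta\in(0,\pi/2]$, then $L\ge 2\pi/\sin\theta$.
   Context: $\mathbb{S}^2$ is the unit sphere in $\mathbb{R}^3$; $\operatorname{dist}(x,\mathcal{C})=\min_{y\in\mathcal{C}}\arccos\langle x,y\rangle$ is the geodesic distance to $\mathcal{C}$. The tube is $T_\theta(\mathcal{C})=\{x\in\mathbb{S}^2:\operatorname{dist}(x,\mathcal{C})\le\theta\}$, and the covering radius of $\mathcal{C}$ is $R=\max_{x\in\mathbb{S}^2}\operatorname{dist}(x,\mathcal{C})$. *)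

(* Defs.v *)
From HB Require Import structures.
From mathcomp Require Export all_boot all_order all_algebra.
From mathcomp Require Export all_classical all_reals all_analysis.
Export Order.TTheory GRing.Theory Num.Theory.
Export numFieldNormedType.Exports.

Set Implicit Arguments.
Unset Strict Implicit.
Unset Printing Implicit Defensive.

Local Open Scope classical_set_scope.
Local Open Scope ring_scope.

Definition dotp {R : realType} (u v : 'rV[R]_3) : R := (u *m v^T) 0 0.

(* The library norm `|u| on row vectors is the sup norm; it induces the same
   topology as the Euclidean norm, but not the same lengths. *)
Definition enorm {R : realType} (u : 'rV[R]_3) : R := Num.sqrt (dotp u u).

Definition sphere2 (R : realType) : set 'rV[R]_3 := [set x | enorm x = 1].
Arguments sphere2 R : clear implicits.

Definition simple_closed_curve {R : realType} (g : R -> 'rV[R]_3) : Prop :=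
  [/\ {within `[0, 1], continuous g},
      g 0 = g 1
    & {in `[0, 1[ &, injective g}].

Definition trace_of {R : realType} (g : R -> 'rV[R]_3) : set 'rV[R]_3 :=
  g @` `[0, 1].

(* Vector-valued analogue of the library's [variation]: the length of the
   polygon inscribed in g with vertices at a and at the points of s. *)
Definition polygon_length {R : realType} (a b : R) (g : R -> 'rV[R]_3)
    (s : seq R) : R :=
  let G := g \o nth b (a :: s) in
  \sum_(0 <= n < size s) enorm (G n.+1 - G n).

Definition curve_length {R : realType} (g : R -> 'rV[R]_3) : \bar R :=
  ereal_sup [set (polygon_length 0 1 g s)%:E | s in itv_partition 0 1].

Definition rectifiable {R : realType} (g : R -> 'rV[R]_3) : Prop :=
  (curve_length g < +oo)%E.

(* For x in the sphere and C a nonempty compact subset of it, the infimum is a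
   minimum by compactness, and so is the supremum in [covering_radius] a
   maximum. *)
Definition geodist {R : realType} (x : 'rV[R]_3) (C : set 'rV[R]_3) : R :=
  inf [set acos (dotp x y) | y in C].

Definition tube {R : realType} (theta : R) (C : set 'rV[R]_3) : set 'rV[R]_3 :=
  [set x | sphere2 R x /\ geodist x C <= theta].

Definition covering_radius {R : realType} (C : set 'rV[R]_3) : R :=
  sup [set geodist x C | x in sphere2 R].

(* Main.v *)
From HB Require Import structures.
Require Import Defs.
From mathcomp Require Import measurable_realfun ring lra.

Set Implicit Arguments.
Unset Strict Implicit.
Unset Printing Implicit Defensive.

Local Open Scope classical_set_scope.
Local Open Scope ring_scope.

(** The inequality L >= 2 pi / sin theta comes from a double count in the style of
    Crofton. Let the centre of a cap of angular radius theta run through the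
    closed curve. If every point x of the sphere and its antipode are within
    theta of the curve, then x is inside the moving cap at some time and outside
    at some other time, so x is left behind at least once. On the other hand,
    when the centre moves by a small distance a, the set of points left behind
    has at most the fraction a sin theta / (2 pi) of the area of the sphere.
    Summing over the edges of a fine inscribed polygon gives
    1 <= L sin theta / (2 pi).

    Areas on the sphere are replaced by volumes of the corresponding cones in
    the unit ball, so that rotation invariance follows from Fubini and the
    factorization of plane rotations into shears (leb2_rot2). The bound on the
    set left behind (leb3_lune_le) needs no integration over the cap: by
    invariance it depends on a only, and for a centre moving around a great
    circle, a point is left behind at most once per turn
    (trig_no_four_alternations), and never unless its latitude is at most
    theta. The points of latitude at most theta form the fraction sin theta of
    the sphere (leb3_band).

    In practice one uses a slightly larger radius, to absorb the difference
    between the curve and a polygon (closed_polygon_arc_length,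
    loop_cover_length). This is impossible for theta = pi/2, where the claim is
    that a curve of length less than 2 pi lies in an open hemisphere
    (loop_hemisphere_length). The statement on the covering radius is the
    contrapositive. *)

(** * Lebesgue measure of the plane and of space *)

Notation lineR R := (measurableTypeR R).
Notation planeR R := (lineR R * lineR R)%type.
Notation spaceR R := (lineR R * lineR R * lineR R)%type.
Notation leb1 := lebesgue_measure.

Lemma measurable_preimage d1 d2 (T1 : measurableType d1) (T2 : measurableType d2)
    (f : T1 -> T2) (A : set T2) :
  measurable_fun setT f -> measurable A -> measurable (f @^-1` A).
Proof. by move=> mf mA; rewrite -[X in measurable X]setTI; exact: mf. Qed.

Section product_lebesgue.
Variable R : realType.

(** Named constants, rather than notations, so that sigma-finiteness of the
    plane measure is found by instance resolution when it enters another
    product. *)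
Definition leb2 : set (planeR R) -> \bar R := (leb1 \x leb1)%E.

HB.instance Definition _ := Measure.on leb2.

Let leb2_sigma_finite : sigma_finite setT leb2.
Proof.
have /sigma_finiteP[F [TF ndF Foo]] := sigma_finiteT (@leb1 R).
exists (fun n => F n `*` F n).
  apply/seteqP; split=> // -[x y] _.
  have [n _ Fnx] : (\bigcup_i F i) x by rewrite -TF.
  have [k _ Fky] : (\bigcup_i F i) y by rewrite -TF.
  exists (maxn n k) => //; split => /=.
    by move: x Fnx {y Fky}; exact/subsetPset/ndF/leq_maxl.
  by move: y Fky {x Fnx}; exact/subsetPset/ndF/leq_maxr.
move=> k; have [mFk Fk] := Foo k; split; first exact: measurableX.
by rewrite /leb2 product_measure1E// lte_mul_pinfty// ge0_fin_numE.
Qed.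

HB.instance Definition _ :=
  Measure_isSigmaFinite.Build _ _ _ leb2 leb2_sigma_finite.

Definition leb3 : set (spaceR R) -> \bar R := (leb2 \x leb1)%E.

HB.instance Definition _ := Measure.on leb3.

End product_lebesgue.
Arguments leb2 {R}.
Arguments leb3 {R}.

(** * Rotation invariance *)

Section lebesgue_invariance.
Variable R : realType.
Implicit Types s t r : R.

Lemma lebesgue_measure_translation t (A : set (lineR R)) : measurable A ->
  leb1 ((fun y : lineR R => y + t) @^-1` A) = leb1 A.
Proof.
move=> mA; pose f := fun y : lineR R => y + t : lineR R.
have mf : measurable_fun setT f by exact: measurable_funD.
apply/esym; apply: (@lebesgue_measure_unique _ (pushforward leb1 f)) => //=.
move=> _ [[a b]] _ <-.
rewrite /pushforward (_ : _ @^-1` _ = `]a - t, b - t]%classic).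
  rewrite !lebesgue_measure_itv/= !lte_fin ltrD2r; case: ifP => // _.
  by rewrite -!EFinB; congr (_%:E); ring.
by apply/seteqP; split=> x /=; rewrite !in_itv/= ltrBlDr lerBrDr.
Qed.

Lemma lebesgue_measure_dilation s (A : set (lineR R)) : 0 < s -> measurable A ->
  leb1 ((fun y : lineR R => y / s) @^-1` A) = (s%:E * leb1 A)%E.
Proof.
move=> s0 mA; pose f := fun y : lineR R => y / s : lineR R.
have si0 : 0 <= s^-1 by rewrite invr_ge0 ltW.
have mf : measurable_fun setT f by exact: measurable_funM.
have [nu nuE] : exists nu : {measure set (lineR R) -> \bar R},
    forall B, nu B = leb1 (f @^-1` B).
  by unshelve eexists (pushforward leb1 f : {measure set _ -> \bar R}).
have -> : leb1 A = mscale (NngNum si0) nu A.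
  apply: (@lebesgue_measure_unique _ (mscale (NngNum si0) nu)) => //.
  move=> _ [[a b]] _ <-.
  rewrite /= /mscale nuE (_ : _ @^-1` _ = `]a * s, b * s]%classic).
    rewrite !lebesgue_measure_itv/= !lte_fin ltr_pM2r//.
    case: ifP => // _; last by rewrite mule0.
    by rewrite -!EFinB -EFinM; congr (_%:E); field; rewrite gt_eqF.
  by apply/seteqP; split=> x /=; rewrite /f !in_itv/= ltr_pdivlMr// ler_pdivrMr.
by rewrite /= /mscale nuE muleA -EFinM mulfV ?gt_eqF// mul1e.
Qed.

(** Slicing along each axis: these three formulas choose the order of
    integration, so that a map acting on some coordinates only can be studied
    slice by slice. *)
Lemma leb2_ysectionE (A : set (planeR R)) : measurable A ->
  (leb2 A = \int[leb1]_y leb1 (ysection A y))%E.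
Proof.
move=> mA; apply: (@product_measure_unique _ _ _ _ _ leb1 leb1
  (leb1 \x^ leb1)%E _ A mA) => B C mB mC; exact: product_measure2E.
Qed.

Lemma leb3_ysectionE (A : set (spaceR R)) : measurable A ->
  (leb3 A = \int[leb1]_z leb2 (ysection A z))%E.
Proof.
move=> mA; apply: (@product_measure_unique _ _ _ _ _ leb2 leb1
  (leb2 \x^ leb1)%E _ A mA) => B C mB mC; exact: product_measure2E.
Qed.

Lemma leb3_sliceE (A : set (spaceR R)) : measurable A ->
  (leb3 A = \int[leb1]_x leb2 [set p | A ((x, p.1), p.2)])%E.
Proof.
move=> mA; have mf := measurable_fun_xsection leb1 mA.
transitivity (\int[leb2]_p leb1 (xsection A p))%E => //.
rewrite /leb2 fubini_tonelli1//; exact: eq_integral.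
Qed.

Definition shear1 t (p : planeR R) : planeR R := (p.1 + t * p.2, p.2).
Definition shear2 t (p : planeR R) : planeR R := (p.1, p.2 + t * p.1).

Lemma measurable_shear1 t : measurable_fun setT (shear1 t).
Proof.
apply: measurable_fun_pair; last exact: measurable_snd.
by apply: measurable_funD; [exact: measurable_fst|exact: measurable_funM].
Qed.

Lemma measurable_shear2 t : measurable_fun setT (shear2 t).
Proof.
apply: measurable_fun_pair; first exact: measurable_fst.
by apply: measurable_funD; [exact: measurable_snd|exact: measurable_funM].
Qed.

Lemma leb2_shear2 t (A : set (planeR R)) : measurable A ->
  leb2 (shear2 t @^-1` A) = leb2 A.
Proof.
move=> mA; rewrite /leb2; apply: eq_integral => x _ /=.
rewrite -[RHS](lebesgue_measure_translation (t * x)); last first.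
  exact: measurable_xsection.
by congr (leb1 _); apply/seteqP; split=> y; rewrite /xsection/= !inE.
Qed.

Lemma leb2_shear1 t (A : set (planeR R)) : measurable A ->
  leb2 (shear1 t @^-1` A) = leb2 A.
Proof.
move=> mA; rewrite !leb2_ysectionE//; last first.
  by apply: measurable_preimage => //; exact: measurable_shear1.
apply: eq_integral => y _ /=.
rewrite -[RHS](lebesgue_measure_translation (t * y)); last first.
  exact: measurable_ysection.
by congr (leb1 _); apply/seteqP; split=> x; rewrite /ysection/= !inE.
Qed.

Lemma measurable_lin2 d (T : measurableType d) (f g : T -> lineR R) (a b : R) :
  measurable_fun setT f -> measurable_fun setT g ->
  measurable_fun setT (fun x => a * f x + b * g x : lineR R).
Proof.
by move=> mf mg; apply: measurable_funD; apply: measurable_funM.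
Qed.

Definition rot2 (p q : R) (x : planeR R) : planeR R :=
  (p * x.1 + - q * x.2, q * x.1 + p * x.2).

Lemma measurable_rot2 p q : measurable_fun setT (rot2 p q).
Proof.
by apply: measurable_fun_pair; apply: measurable_lin2.
Qed.

(** A plane rotation other than a half turn is a product of three shears, and a
    shear translates every line parallel to an axis, so it preserves area by
    Fubini. *)
Lemma leb2_rot2 p q (A : set (planeR R)) : p ^+ 2 + q ^+ 2 = 1 ->
  measurable A -> leb2 (rot2 p q @^-1` A) = leb2 A.
Proof.
have generic p' q' (B : set (planeR R)) : q' != 0 -> p' ^+ 2 + q' ^+ 2 = 1 ->
    measurable B -> leb2 (rot2 p' q' @^-1` B) = leb2 B.
  move=> q0 pq mB; set t := (p' - 1) / q'.
  have -> : rot2 p' q' = shear1 t \o shear2 q' \o shear1 t.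
    apply/funext => -[x y]; rewrite /rot2 /shear1 /shear2 /t /=; congr pair; last first.
      by field.
    rewrite [in LHS](_ : q' = (1 - p' ^+ 2) / q'); first by field.
    by rewrite -pq; field.
  have mB1 := measurable_preimage (measurable_shear1 t) mB.
  have mB2 := measurable_preimage (measurable_shear2 q') mB1.
  by rewrite -(leb2_shear1 t mB) -(leb2_shear2 q' mB1) -(leb2_shear1 t mB2).
move=> pq mA; have [q0|q0] := eqVneq q 0; last exact: generic.
(* With q = 0 the map is the identity or the half turn, and the half turn is the
   square of a quarter turn. *)
move: pq; rewrite q0 expr0n addr0 => /eqP; rewrite sqrf_eq1 => /orP[]/eqP ->.
  congr (_ _); apply/seteqP; split => -[x y];
  by rewrite /rot2/= oppr0 !mul0r !mul1r addr0 add0r.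
have q1 : (0 : R) ^+ 2 + 1 ^+ 2 = 1 by rewrite expr0n expr1n add0r.
have -> : rot2 (-1) 0 = rot2 0 1 \o rot2 0 1.
  by apply/funext => -[x y]; rewrite /rot2 /=; congr pair; ring.
rewrite comp_preimage generic ?oner_eq0//; first by rewrite generic ?oner_eq0.
by apply: measurable_preimage => //; exact: measurable_rot2.
Qed.

(** Rotations in the first two and in the last two coordinates. Together they
    bring any pair of unit vectors into a coordinate plane, so invariance under
    these two families is all the rotation invariance that is needed. *)
Definition rot12 (p q : R) (x : spaceR R) : spaceR R := (rot2 p q x.1, x.2).

Definition rot23 (p q : R) (x : spaceR R) : spaceR R :=
  let y := rot2 p q (x.1.2, x.2) in ((x.1.1, y.1), y.2).

Lemma measurable_rot12 p q : measurable_fun setT (rot12 p q).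
Proof.
apply: measurable_fun_pair; last exact: measurable_snd.
exact: (measurableT_comp (measurable_rot2 p q) measurable_fst).
Qed.

Lemma measurable_coord1 : measurable_fun setT (fun x : spaceR R => x.1.1).
Proof. exact: (measurableT_comp measurable_fst measurable_fst). Qed.

Lemma measurable_coord2 : measurable_fun setT (fun x : spaceR R => x.1.2).
Proof. exact: (measurableT_comp measurable_snd measurable_fst). Qed.

Lemma measurable_coord3 : measurable_fun setT (fun x : spaceR R => x.2).
Proof. exact: measurable_snd. Qed.

Lemma measurable_rot23 p q : measurable_fun setT (rot23 p q).
Proof.
have mc := measurable_coord2; have ms := measurable_coord3.
apply: measurable_fun_pair; last exact: measurable_lin2.
apply: measurable_fun_pair; last exact: measurable_lin2.
exact: measurable_coord1.
Qed.

Lemma leb3_rot12 p q (A : set (spaceR R)) : p ^+ 2 + q ^+ 2 = 1 ->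
  measurable A -> leb3 (rot12 p q @^-1` A) = leb3 A.
Proof.
move=> pq mA; have mA' := measurable_preimage (measurable_rot12 p q) mA.
rewrite (leb3_ysectionE mA) (leb3_ysectionE mA'); apply: eq_integral => z _.
rewrite -(leb2_rot2 pq (measurable_ysection z mA)).
by congr (leb2 _); apply/seteqP; split => x; rewrite /ysection/= !inE.
Qed.

Lemma leb3_rot23 p q (A : set (spaceR R)) : p ^+ 2 + q ^+ 2 = 1 ->
  measurable A -> leb3 (rot23 p q @^-1` A) = leb3 A.
Proof.
move=> pq mA; have mA' := measurable_preimage (measurable_rot23 p q) mA.
rewrite (leb3_sliceE mA) (leb3_sliceE mA'); apply: eq_integral => x _.
rewrite -[RHS](leb2_rot2 pq)//.
apply: measurable_preimage mA; apply: measurable_fun_pair => //.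
by apply: measurable_fun_pair.
Qed.

End lebesgue_invariance.

(** * The unit ball and its equatorial band *)

Section ball_and_band.
Variable R : realType.
Implicit Types (p q r s c : R) (x u v : spaceR R).

Definition ip x u : R := x.1.1 * u.1.1 + x.1.2 * u.1.2 + x.2 * u.2.

Definition ball3 : set (spaceR R) := [set x | ip x x < 1].

Definition disc r : set (planeR R) := [set p : planeR R | p.1 ^+ 2 + p.2 ^+ 2 < r].

Lemma measurable_lt_set d (T : measurableType d) (f g : T -> R) :
  measurable_fun setT f -> measurable_fun setT g ->
  measurable [set z | f z < g z].
Proof.
move=> mf mg; rewrite (_ : [set z | _] = (fun z => f z < g z) @^-1` [set true])//.
by apply: measurable_preimage => //; exact: measurable_fun_ltr.
Qed.

Lemma measurable_le_set d (T : measurableType d) (f g : T -> R) :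
  measurable_fun setT f -> measurable_fun setT g ->
  measurable [set z | f z <= g z].
Proof.
move=> mf mg; rewrite (_ : [set z | _] = (fun z => f z <= g z) @^-1` [set true])//.
by apply: measurable_preimage => //; exact: measurable_fun_ler.
Qed.

Lemma measurable_sqr1 : measurable_fun setT (fun p : planeR R => p.1 ^+ 2 + p.2 ^+ 2 : R).
Proof. by apply: measurable_funD; apply: measurable_funX. Qed.

Lemma measurable_disc r : measurable (disc r).
Proof.
by apply: measurable_lt_set; [exact: measurable_sqr1|exact: measurable_cst].
Qed.

Lemma measurable_ip u : measurable_fun setT (ip ^~ u : spaceR R -> R).
Proof.
have ms := @measurable_coord3 R.
apply: measurable_funD; last by apply: measurable_funM.
by apply: measurable_funD; apply: measurable_funM;
  [exact: measurable_coord1| |exact: measurable_coord2|].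
Qed.

Lemma measurable_ip2 : measurable_fun setT (fun x => ip x x).
Proof.
have m1 := @measurable_coord1 R; have m2 := @measurable_coord2 R.
have m3 := @measurable_coord3 R.
by apply: measurable_funD; [apply: measurable_funD|]; apply: measurable_funM.
Qed.

Lemma measurable_ball3 : measurable ball3.
Proof.
by apply: measurable_lt_set; [exact: measurable_ip2|exact: measurable_cst].
Qed.

Lemma leb2_dilation2 s (A : set (planeR R)) : 0 < s -> measurable A ->
  leb2 [set p : planeR R | A (p.1, p.2 / s)] = (s%:E * leb2 A)%E.
Proof.
move=> s0 mA.
rewrite /leb2 -(@ge0_integralZl _ _ _ leb1 _ measurableT)//; last 2 first.
- exact: measurable_fun_xsection.
- by rewrite lee_fin ltW.
apply: eq_integral => x _.
rewrite -(lebesgue_measure_dilation s0 (measurable_xsection x mA)).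
by congr (leb1 _); apply/seteqP; split => y; rewrite /xsection/= !inE.
Qed.

Lemma leb2_dilation1 s (A : set (planeR R)) : 0 < s -> measurable A ->
  leb2 [set p : planeR R | A (p.1 / s, p.2)] = (s%:E * leb2 A)%E.
Proof.
move=> s0 mA.
have mA' : measurable [set p : planeR R | A (p.1 / s, p.2)].
  apply: (@measurable_preimage _ _ _ _ (fun p : planeR R => (p.1 / s, p.2))) mA.
  by apply: measurable_fun_pair => //; apply: measurable_funM.
rewrite (leb2_ysectionE mA) (leb2_ysectionE mA').
rewrite -(@ge0_integralZl _ _ _ leb1 _ measurableT)//; last 2 first.
- exact: measurable_fun_ysection.
- by rewrite lee_fin ltW.
apply: eq_integral => y _.
rewrite -(lebesgue_measure_dilation s0 (measurable_ysection y mA)).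
by congr (leb1 _); apply/seteqP; split => x; rewrite /ysection/= !inE.
Qed.

Lemma leb3_dilation3 s (A : set (spaceR R)) : 0 < s -> measurable A ->
  leb3 [set x : spaceR R | A (x.1, x.2 / s)] = (s%:E * leb3 A)%E.
Proof.
move=> s0 mA.
rewrite /leb3 -(@ge0_integralZl _ _ _ leb2 _ measurableT)//; last 2 first.
- exact: measurable_fun_xsection.
- by rewrite lee_fin ltW.
apply: eq_integral => x _.
rewrite -(lebesgue_measure_dilation s0 (measurable_xsection x mA)).
by congr (leb1 _); apply/seteqP; split => y; rewrite /xsection/= !inE.
Qed.

(** Only the proportionality to the squared radius matters: the constant, which
    is pi, cancels in the end. *)
Lemma leb2_disc r : 0 <= r -> leb2 (disc r) = (r%:E * leb2 (disc 1))%E.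
Proof.
rewrite le_eqVlt => /predU1P[<-|r0].
  rewrite mul0e (_ : disc 0 = set0) ?measure0// -subset0 => p.
  by rewrite /disc/= ltNge addr_ge0// sqr_ge0.
have s0 : 0 < Num.sqrt r by rewrite sqrtr_gt0.
have m1 : measurable [set p : planeR R | disc 1 (p.1, p.2 / Num.sqrt r)].
  apply: (@measurable_preimage _ _ _ _ (fun p : planeR R => (p.1, p.2 / _)))
    (measurable_disc 1).
  by apply: measurable_fun_pair => //; apply: measurable_funM.
rewrite -[in RHS](sqr_sqrtr (ltW r0)) expr2 EFinM -muleA.
rewrite -(leb2_dilation2 s0 (measurable_disc 1)) -(leb2_dilation1 s0 m1).
congr (leb2 _); apply/seteqP; split => -[x y];
by rewrite /disc/= !expr_div_n sqr_sqrtr ?(ltW r0)// -mulrDl ltr_pdivrMr// mul1r.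
Qed.

Lemma leb1_open_unit : exists I : set (lineR R),
  [/\ measurable I, leb1 I = 2%:E & forall a : R, a ^+ 2 < 1 -> I a].
Proof.
exists `]-1, 1[%classic; split; first exact: measurable_itv.
  rewrite lebesgue_measure_itv/= ifT ?lte_fin ?gtrN//.
  by rewrite -EFinB; congr (_%:E); ring.
by move=> a a1; rewrite /= in_itv/=; apply/andP; split; nra.
Qed.

Lemma leb2_disc1_fin_num : (leb2 (disc 1) \is a fin_num)%E.
Proof.
have [I [mI I2 sqr_lt1]] := leb1_open_unit.
rewrite ge0_fin_numE ?measure_ge0//.
apply: (@le_lt_trans _ _ (leb2 (I `*` I))); last first.
  by rewrite /leb2 (product_measure1E leb1 leb1 mI mI) /= I2 -EFinM ltry.
apply: le_measure; rewrite ?inE.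
- exact: measurable_disc.
- exact: measurableX.
move=> [x y]; rewrite /disc /= => xy1; split => /=; apply: sqr_lt1;
by apply: le_lt_trans xy1; rewrite ?lerDl ?lerDr sqr_ge0.
Qed.

Lemma leb3_ball3_fin_num : (leb3 ball3 \is a fin_num)%E.
Proof.
have [I [mI I2 sqr_lt1]] := leb1_open_unit.
have mD := measurable_disc 1.
rewrite ge0_fin_numE ?measure_ge0//.
apply: (@le_lt_trans _ _ (leb3 (disc 1 `*` I))); last first.
  rewrite /leb3 (product_measure1E leb2 leb1 mD mI) /= I2.
  by rewrite lte_mul_pinfty ?measure_ge0 ?leb2_disc1_fin_num// ltry.
apply: le_measure; rewrite ?inE.
- exact: measurable_ball3.
- exact: measurableX.
move=> [[x y] z]; rewrite /ball3 /ip /disc /= => xy1; split => /=; last first.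
  by apply: sqr_lt1; nra.
by nra.
Qed.

Lemma leb3_ball3_gt0 : (0 < leb3 ball3)%E.
Proof.
have [J [mJ J2 JP]] : exists J : set (lineR R),
    [/\ measurable J, leb1 J = (2^-1)%:E & forall a : R, J a -> 0 < a < 2^-1].
  exists `]0, 2^-1[%classic; split; first exact: measurable_itv.
    by rewrite lebesgue_measure_itv/= ifT ?lte_fin// -EFinB subr0.
  by move=> a; rewrite /= in_itv.
have mJJ : measurable (J `*` J) by exact: measurableX.
apply: (@lt_le_trans _ _ (leb3 ((J `*` J) `*` J))).
  rewrite /leb3 (product_measure1E leb2 leb1 mJJ mJ) /=.
  rewrite /leb2 (product_measure1E leb1 leb1 mJ mJ) /= J2.
  by rewrite -!EFinM lte_fin.
apply: le_measure; rewrite ?inE.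
- exact: measurableX.
- exact: measurable_ball3.
move=> [[x y] z] /= [[/JP + /JP] + /JP]; rewrite /ball3 /ip /=.
by move=> /andP[? ?] /andP[? ?] /andP[? ?]; nra.
Qed.

(** The part of the unit ball over the points of the sphere whose latitude t
    satisfies cos t >= c. *)
Definition band c : set (spaceR R) :=
  [set x | ip x x < 1 /\ c ^+ 2 * ip x x <= x.1.1 ^+ 2 + x.1.2 ^+ 2].

Lemma measurable_band c : measurable (band c).
Proof.
apply: measurableI; first exact: measurable_ball3.
apply: measurable_le_set.
  by apply: measurable_funM => //; exact: measurable_ip2.
exact: (measurableT_comp measurable_sqr1 measurable_fst).
Qed.

(** Archimedes: the band has the volume of the ball shrunk by s along the polar
    axis. At height z the band is the annulus c^2 z^2 / s^2 <= rho^2 < 1 - z^2,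
    the shrunk ball is the disc rho^2 < 1 - z^2 / s^2, and c^2 + s^2 = 1 makes
    the areas agree. *)
Lemma leb3_band c s : 0 < s -> c ^+ 2 + s ^+ 2 = 1 ->
  (leb3 (band c) <= s%:E * leb3 ball3)%E.
Proof.
move=> s0 cs; rewrite -(leb3_dilation3 s0 measurable_ball3).
set E := [set x : spaceR R | _].
have mE : measurable E.
  apply: (@measurable_preimage _ _ _ _ (fun x : spaceR R => (x.1, x.2 / s)))
    measurable_ball3.
  by apply: measurable_fun_pair => //; apply: measurable_funM.
have mB := measurable_band c.
rewrite (leb3_ysectionE mB) (leb3_ysectionE mE).
apply: ge0_le_integral => //.
- exact: measurable_fun_ysection.
- exact: measurable_fun_ysection.
move=> z _.
pose r1 := c ^+ 2 * z ^+ 2 / s ^+ 2; pose r2 := 1 - z ^+ 2.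
have s20 : 0 < s ^+ 2 by rewrite exprn_gt0.
have r1_ge0 : 0 <= r1.
  by rewrite divr_ge0 ?sqr_ge0// mulr_ge0 ?sqr_ge0.
have r21 : r2 - r1 = 1 - (z / s) ^+ 2.
  have cE : c ^+ 2 = 1 - s ^+ 2 by rewrite -cs; ring.
  by rewrite /r2 /r1 cE; field; rewrite gt_eqF.
have -> : ysection (band c) z = disc r2 `\` disc r1.
  apply/seteqP; split => -[x y]; rewrite /ysection/= inE /band /disc /ip /r1 /r2 /=.
    move=> [h1 h2]; split; first by nra.
    by apply/negP; rewrite -leNgt ler_pdivrMr//; nra.
  move=> [h1 /negP]; rewrite -leNgt ler_pdivrMr// => h2.
  by split; nra.
have -> : ysection E z = disc (r2 - r1).
  apply/seteqP; split => -[x y]; rewrite /ysection/= inE /E /ball3 /disc r21 /ip /=;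
  by move=> h; nra.
have [r12|r21'] := leP r1 r2; last first.
  rewrite (_ : _ `\` _ = set0) ?measure0 ?measure_ge0// -subset0 => -[x y] [].
  by rewrite /disc /= => h1; apply; exact: lt_trans r21'.
have disc_fin r : 0 <= r -> (leb2 (disc r) \is a fin_num)%E.
  by move=> r0; rewrite leb2_disc// fin_numM// leb2_disc1_fin_num.
have r2_ge0 := le_trans r1_ge0 r12.
rewrite measureD; [|exact: measurable_disc..|]; last first.
  by rewrite -ge0_fin_numE ?measure_ge0 ?disc_fin.
rewrite setIidr; last by move=> p /= /lt_le_trans; exact.
rewrite /= (leb2_disc r2_ge0) (leb2_disc r1_ge0) (@leb2_disc (r2 - r1)) ?subr_ge0//.
by rewrite -(fineK leb2_disc1_fin_num) -!EFinM -EFinB (mulrBl _ r2) lexx.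
Qed.

End ball_and_band.

(** * Volume of the difference of two caps *)

Section lune_volume.
Variable R : realType.
Implicit Types (p q s c t : R) (x y u v : spaceR R).

(** This is the determinant of the rows (1, cos t, sin t) at three successive
    points of the circle; it equals 4 sin x sin y sin (x + y) for the half
    differences x and y. *)
Lemma sin_triple_gt0 a b c : a < b -> b < c -> c < a + 2 * pi ->
  0 < sin (b - a) + sin (c - b) - sin (c - a) :> R.
Proof.
move=> ab bc ca; pose x := (b - a) / 2; pose y := (c - b) / 2.
have -> : sin (b - a) + sin (c - b) - sin (c - a) =
    4 * sin x * sin y * sin (x + y).
  have -> : b - a = x + x by rewrite /x; field.
  have -> : c - b = y + y by rewrite /y; field.
  have -> : c - a = (x + x) + (y + y) by rewrite /x /y; field.
  rewrite !sinD !cosD.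
  have cx : cos x ^+ 2 = 1 - sin x ^+ 2 by rewrite -(cos2Dsin2 x); ring.
  have cy : cos y ^+ 2 = 1 - sin y ^+ 2 by rewrite -(cos2Dsin2 y); ring.
  by ring: cx cy.
have s0 z : 0 < z < pi -> 0 < sin z by exact: sin_gt0_pi.
rewrite !mulr_gt0// s0//; apply/andP; split; rewrite /x /y; lra.
Qed.

(** A line meets a circle at most twice. Write F t = p cos t + q sin t - d:
    the values of F at four points satisfy a linear relation with alternating
    signs whose coefficients are the positive determinants of the previous
    lemma, so they cannot alternate in sign themselves. *)
Lemma trig_no_four_alternations (p q d t0 t1 t2 t3 : R) :
  t0 < t1 -> t1 <= t2 -> t2 < t3 -> t3 < t0 + 2 * pi ->
  d <= p * cos t0 + q * sin t0 -> p * cos t1 + q * sin t1 < d ->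
  d <= p * cos t2 + q * sin t2 -> p * cos t3 + q * sin t3 < d -> False.
Proof.
move=> t01; rewrite le_eqVlt => /predU1P[<-|t12] t23 t30 F0 F1 F2 F3.
  by move: F1; rewrite ltNge F2.
have D123 := @sin_triple_gt0 t1 t2 t3 t12 t23 ltac:(lra).
have D023 := @sin_triple_gt0 t0 t2 t3 ltac:(lra) t23 t30.
have D013 := @sin_triple_gt0 t0 t1 t3 t01 ltac:(lra) t30.
have D012 := @sin_triple_gt0 t0 t1 t2 t01 t12 ltac:(lra).
move: D123 D023 D013 D012.
set D123 := sin _ + _ - _; set D023 := sin _ + _ - _.
set D013 := sin _ + _ - _; set D012 := sin _ + _ - _.
move=> p123 p023 p013 p012.
have : (p * cos t0 + q * sin t0 - d) * D123 - (p * cos t1 + q * sin t1 - d) * D023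
   + (p * cos t2 + q * sin t2 - d) * D013 - (p * cos t3 + q * sin t3 - d) * D012 = 0.
  by rewrite /D123 /D023 /D013 /D012 !sinB; ring.
have : 0 <= (p * cos t0 + q * sin t0 - d) * D123.
  by apply: mulr_ge0; [rewrite subr_ge0|exact: ltW].
have : 0 <= (p * cos t2 + q * sin t2 - d) * D013.
  by apply: mulr_ge0; [rewrite subr_ge0|exact: ltW].
have : (p * cos t1 + q * sin t1 - d) * D023 < 0.
  by rewrite pmulr_llt0// subr_lt0.
have : (p * cos t3 + q * sin t3 - d) * D012 < 0.
  by rewrite pmulr_llt0// subr_lt0.
by lra.
Qed.

Definition len x : R := Num.sqrt (ip x x).

Lemma ip_ge0 x : 0 <= ip x x.
Proof. by rewrite /ip -!expr2 !addr_ge0 ?sqr_ge0. Qed.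

Lemma len_ge0 x : 0 <= len x. Proof. exact: sqrtr_ge0. Qed.

Lemma sqr_len x : len x ^+ 2 = ip x x.
Proof. by rewrite sqr_sqrtr ?ip_ge0. Qed.

(** The part of the unit ball over the points of the sphere that lie in the cap
    of angular radius arccos c centred at u but not in the one centred at v. *)
Definition lune c u v : set (spaceR R) :=
  [set x | ip x x < 1 /\ (c * len x <= ip x u /\ ip x v < c * len x)].

Lemma measurable_clen c : measurable_fun setT (fun x => c * len x).
Proof.
apply: measurable_funM; first exact: measurable_cst.
apply: (@measurableT_comp _ _ _ _ _ _ (@Num.sqrt R)); last exact: measurable_ip2.
by apply: continuous_measurable_fun; exact: sqrt_continuous.
Qed.

Lemma measurable_lune c u v : measurable (lune c u v).
Proof.
have mc := measurable_clen c.
apply: measurableI; first exact: measurable_ball3.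
by apply: measurableI; [apply: measurable_le_set|apply: measurable_lt_set];
  rewrite //; exact: measurable_ip.
Qed.

Lemma lune_ball c u v : lune c u v `<=` @ball3 R.
Proof. by move=> x []. Qed.

Lemma leb3_lune_fin_num c u v : (leb3 (lune c u v) \is a fin_num)%E.
Proof.
rewrite ge0_fin_numE ?measure_ge0//.
apply: (@le_lt_trans _ _ (leb3 (@ball3 R))); last first.
  by rewrite -ge0_fin_numE ?measure_ge0// leb3_ball3_fin_num.
apply: le_measure; rewrite ?inE; first exact: measurable_lune.
  exact: measurable_ball3.
exact: lune_ball.
Qed.

Lemma ip_rot12 p q x y : p ^+ 2 + q ^+ 2 = 1 ->
  ip (rot12 p q x) (rot12 p q y) = ip x y.
Proof.
move=> pq; rewrite /ip /rot12 /rot2/=.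
by rewrite -[x.1.1 * y.1.1]mul1r -[x.1.2 * y.1.2]mul1r -pq; ring.
Qed.

Lemma ip_rot23 p q x y : p ^+ 2 + q ^+ 2 = 1 ->
  ip (rot23 p q x) (rot23 p q y) = ip x y.
Proof.
move=> pq; rewrite /ip /rot23 /rot2/=.
by rewrite -[x.2 * y.2]mul1r -[x.1.2 * y.1.2]mul1r -pq; ring.
Qed.

Lemma leb3_lune_rot12 p q c u v : p ^+ 2 + q ^+ 2 = 1 ->
  leb3 (lune c (rot12 p q u) (rot12 p q v)) = leb3 (lune c u v).
Proof.
move=> pq; rewrite -(leb3_rot12 pq); last exact: measurable_lune.
congr (leb3 _); apply/seteqP; split => x;
by rewrite /lune /len /= !ip_rot12.
Qed.

Lemma leb3_lune_rot23 p q c u v : p ^+ 2 + q ^+ 2 = 1 ->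
  leb3 (lune c (rot23 p q u) (rot23 p q v)) = leb3 (lune c u v).
Proof.
move=> pq; rewrite -(leb3_rot23 pq); last exact: measurable_lune.
congr (leb3 _); apply/seteqP; split => x;
by rewrite /lune /len /= !ip_rot23.
Qed.

Definition dir t : spaceR R := ((cos t, sin t), 0).

Lemma rot12_dir a t : rot12 (cos a) (sin a) (dir t) = dir (a + t).
Proof. by rewrite /rot12 /rot2 /dir /= cosD sinD; congr (((_, _), _)); ring. Qed.

(** The rotation that sends (a, b) to the nonnegative first half-axis. *)
Lemma givens_rotation (a b : R) :
  exists p q, [/\ p ^+ 2 + q ^+ 2 = 1, q * a + p * b = 0 & 0 <= p * a + - q * b].
Proof.
have [ab0|ab0] := eqVneq (a ^+ 2 + b ^+ 2) 0.
  exists 1, 0.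
  have a0 : a = 0 by nra.
  have b0 : b = 0 by nra.
  by rewrite a0 b0; split; [ring|ring|rewrite !mulr0 addr0].
have r0 : 0 < a ^+ 2 + b ^+ 2 by rewrite lt_neqAle eq_sym ab0 addr_ge0 ?sqr_ge0.
pose r := Num.sqrt (a ^+ 2 + b ^+ 2).
have rr : r ^+ 2 = a ^+ 2 + b ^+ 2 by rewrite sqr_sqrtr ?ltW.
have r_gt0 : 0 < r by rewrite sqrtr_gt0.
exists (a / r), (- b / r); split.
- by rewrite !expr_div_n rr sqrrN -mulrDl divff.
- by field; rewrite gt_eqF.
- rewrite [leRHS](_ : _ = r ^+ 2 / r) ?divr_ge0 ?sqr_ge0 ?ltW//.
  by rewrite rr; field; rewrite gt_eqF.
Qed.

(** Three Givens rotations make u the first basis vector and put v in the half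
    plane spanned by the first two. *)
Lemma leb3_lune_dir c u v : ip u u = 1 -> ip v v = 1 ->
  leb3 (lune c u v) = leb3 (lune c (dir 0) (dir (acos (ip u v)))).
Proof.
move=> u1 v1.
have [p [q [pq u3 _]]] := givens_rotation u.1.2 u.2.
rewrite -(leb3_lune_rot23 _ _ _ pq) -(ip_rot23 u v pq).
move: u1 v1; rewrite -(ip_rot23 u u pq) -(ip_rot23 v v pq).
have : (rot23 p q u).2 = 0 by [].
move: (rot23 p q u) (rot23 p q v) => {u3 pq p q} {}u {}v u3 u1 v1.
have [p [q [pq u2 u_ge0]]] := givens_rotation u.1.1 u.1.2.
rewrite -(leb3_lune_rot12 _ _ _ pq) -(ip_rot12 u v pq).
move: u1 v1; rewrite -(ip_rot12 u u pq) -(ip_rot12 v v pq).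
have : (rot12 p q u).2 = 0 by [].
have : (rot12 p q u).1.2 = 0 by [].
have : 0 <= (rot12 p q u).1.1 by [].
move: (rot12 p q u) (rot12 p q v) => {u3 u2 u_ge0 pq p q} {}u {}v u_ge0 u2 u3 u1 v1.
have {u_ge0 u2 u3 u1} uE : u = ((1, 0), 0).
  case: u u_ge0 u2 u3 u1 => -[a b] d /= a0 b0 d0; rewrite /ip /= b0 d0.
  rewrite !mulr0 !addr0 -expr2 => /eqP; rewrite sqrf_eq1 => /orP[/eqP ->//|/eqP a1].
  by move: a0; rewrite a1 lerNr oppr0 ler10.
have [p [q [pq v3 v_ge0]]] := givens_rotation v.1.2 v.2.
rewrite -(leb3_lune_rot23 _ _ _ pq) -(ip_rot23 u v pq).
move: v1; rewrite -(ip_rot23 v v pq).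
have -> : rot23 p q u = dir 0.
  by rewrite uE /rot23 /rot2 /dir /= cos0 sin0 !mulr0 !addr0.
have : (rot23 p q v).2 = 0 by [].
have : 0 <= (rot23 p q v).1.2 by [].
move: (rot23 p q v) => {uE pq v3 v_ge0 p q u} {}v.
case: v => -[a b] d /= b0 d0; rewrite /ip /= d0 cos0 sin0.
rewrite mul1r !mul0r !addr0 -!expr2 => ab.
congr (leb3 (lune _ _ _)); rewrite /dir; congr (((_, _), _)).
  by rewrite acosK// in_itv/=; apply/andP; split; nra.
rewrite sin_acos; last by apply/andP; split; nra.
by rewrite (_ : 1 - a ^+ 2 = b ^+ 2) ?sqrtr_sqr ?ger0_norm// -ab; ring.
Qed.

(** Let the centre of the cap move along the equator in n steps of a, which do
    not complete a turn. A point leaves the moving cap at most once per turn, so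
    the n successive lunes, which are congruent, are disjoint; and points
    outside the band are too far from the equator to be in any of the caps. *)
Lemma leb3_lune_dir_le c s a n : 0 <= c -> 0 < s -> c ^+ 2 + s ^+ 2 = 1 ->
  0 < a -> n%:R * a < 2 * pi ->
  n%:R * fine (leb3 (lune c (dir 0) (dir a))) <= s * fine (leb3 (@ball3 R)).
Proof.
move=> c0 s0 cs a0 na.
pose L k := lune c (dir (k%:R * a)) (dir (k.+1%:R * a)).
have mL k : measurable (L k) by exact: measurable_lune.
have LE k : leb3 (L k) = leb3 (lune c (dir 0) (dir a)).
  rewrite -(leb3_lune_rot12 c (dir 0) (dir a) (cos2Dsin2 (k%:R * a))).
  rewrite !rot12_dir addr0 /L; congr (leb3 (lune _ _ (dir _))).
  by rewrite -addn1 natrD; ring.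
have ipE x t : ip x (dir t) = x.1.1 * cos t + x.1.2 * sin t.
  by rewrite /ip /= mulr0 addr0.
have tL : trivIset `I_n L.
  have disj i j : (i < j < n)%N -> L i `&` L j = set0.
    move=> /andP[ij jn]; rewrite -subset0 => x [[_ []]]; rewrite !ipE => F0 F1.
    move=> [_ []]; rewrite !ipE => F2 F3.
    apply: (trig_no_four_alternations _ _ _ _ F0 F1 F2 F3).
    - by rewrite ltr_pM2r// ltr_nat.
    - by rewrite ler_pM2r// ler_nat.
    - by rewrite ltr_pM2r// ltr_nat.
    - apply: (@le_lt_trans _ _ (n%:R * a)); first by rewrite ler_pM2r// ler_nat.
      by apply: (lt_le_trans na); rewrite lerDr mulr_ge0// ltW.
  apply/trivIsetP => i j /= i_n jn; rewrite neq_ltn => /orP[ij|ji].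
    by rewrite disj// ij.
  by rewrite setIC disj// ji.
have LB : \big[setU/set0]_(k < n) L k `<=` band c.
  rewrite -bigcup_mkord => x [k _ [x1 [kx _]]]; split => //.
  move: kx; rewrite ipE => kx.
  have cx : 0 <= c * len x by rewrite mulr_ge0// len_ge0.
  rewrite -sqr_len -exprMn.
  apply: (@le_trans _ _ ((x.1.1 * cos (k%:R * a) + x.1.2 * sin (k%:R * a)) ^+ 2)).
    by rewrite ler_sqr ?nnegrE// (le_trans cx).
  have := sqr_ge0 (x.1.1 * sin (k%:R * a) - x.1.2 * cos (k%:R * a)).
  have := cos2Dsin2 (k%:R * a); set C := cos _; set S := sin _ => CS h.
  rewrite -subr_ge0 (le_trans h)// le_eqVlt; apply/orP; left; apply/eqP.
  by rewrite -[in RHS](mul1r (x.1.1 ^+ 2)) -[in RHS](mul1r (x.1.2 ^+ 2)) -CS; ring.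
have mU : measurable (\big[setU/set0]_(k < n) L k).
  by apply: bigsetU_measurable => *; exact: mL.
have UE : leb3 (\big[setU/set0]_(k < n) L k) =
    (fine (leb3 (lune c (dir 0) (dir a))) *+ n)%:E.
  transitivity (\sum_(k < n) leb3 (L k))%E.
    exact: (measure_semi_additive_ord_I leb3 (fun k _ => mL k) tL mU).
  rewrite (eq_bigr (fun=> (fine (leb3 (lune c (dir 0) (dir a))))%:E)).
    by rewrite sumEFin sumr_const card_ord.
  by move=> k _; rewrite LE fineK// leb3_lune_fin_num.
rewrite mulr_natl.
have : ((fine (leb3 (lune c (dir 0) (dir a))) *+ n)%:E <= s%:E * leb3 (@ball3 R))%E.
  rewrite -UE; apply: le_trans (leb3_band s0 cs).
  by apply: le_measure; rewrite ?inE//; exact: measurable_band.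
by rewrite -(fineK (leb3_ball3_fin_num R)) -EFinM lee_fin.
Qed.

End lune_volume.

(** * Closed spherical polygons *)

Section polygon.
Variable R : realType.
Implicit Types (s c : R) (x u v : spaceR R).

Lemma ip_cauchy u v : ip u u = 1 -> ip v v = 1 -> -1 <= ip u v <= 1.
Proof.
rewrite /ip; case: u => -[u1 u2] u3; case: v => -[v1 v2] v3 /= uu vv.
have h1 := sqr_ge0 (u1 - v1); have h2 := sqr_ge0 (u2 - v2).
have h3 := sqr_ge0 (u3 - v3); have k1 := sqr_ge0 (u1 + v1).
have k2 := sqr_ge0 (u2 + v2); have k3 := sqr_ge0 (u3 + v3).
by apply/andP; split; nra.
Qed.

(** The volume of a lune is at most a s V / (2 pi) up to second order in the
    distance a of the centres, V being the volume of the ball: about 2 pi / a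
    congruent lunes fit into the band, and rounding that number costs the term
    2 a on the left. *)
Lemma leb3_lune_le c s u v : 0 <= c -> 0 < s -> c ^+ 2 + s ^+ 2 = 1 ->
  ip u u = 1 -> ip v v = 1 ->
  (2 * pi - 2 * acos (ip u v)) * fine (leb3 (lune c u v)) <=
    acos (ip u v) * (s * fine (leb3 (@ball3 R))).
Proof.
move=> c0 s0 cs u1 v1; rewrite (leb3_lune_dir c u1 v1).
have uv := ip_cauchy u1 v1.
have := acos_lepi uv; have := acos_ge0 uv; move: (acos _) => a {uv}.
rewrite le_eqVlt => /predU1P[<- _|a0 api].
  rewrite (_ : lune _ _ _ = set0) ?measure0 ?mulr0 ?mul0r// -subset0 => x [_ []].
  by rewrite leNgt => /negP.
have := @truncn_itv R (2 * pi / a - 1).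
have pa : 2 <= 2 * pi / a by rewrite ler_pdivlMr// ler_pM2l.
rewrite subr_ge0 (le_trans _ pa) ?ler1n// => /(_ isT)/andP[].
(* n is kept strictly below 2 pi / a, as the lunes must not close up. *)
set n := Num.truncn _ => n1 n2.
have na : n%:R * a < 2 * pi.
  by rewrite -ltr_pdivlMr//; apply: le_lt_trans n1 _; rewrite ltrBlDr ltrDl.
have na' : 2 * pi - 2 * a <= n%:R * a.
  move: n2; rewrite -addn1 natrD ltrBlDr ltr_pdivrMr// => n2.
  by rewrite lerBlDr; apply: ltW; apply: lt_le_trans n2 _; rewrite !mulrDl; lra.
have vol_ge0 : 0 <= fine (leb3 (lune c (dir 0) (dir a))).
  by rewrite fine_ge0// measure_ge0.
apply: (le_trans (ler_wpM2r vol_ge0 na')).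
by rewrite mulrAC mulrC ler_pM2l//; exact: leb3_lune_dir_le.
Qed.

Lemma set1_originE :
  [set (((0, 0), 0) : spaceR R)] = ([set 0] `*` [set 0]) `*` [set 0].
Proof. by apply/seteqP; split => [_ ->//|[[x y] z]] [[/= -> ->] ->]. Qed.

Let m0 : measurable ([set 0] : set (lineR R)). Proof. exact: measurable_set1. Qed.

Let m00 : measurable ([set 0] `*` [set 0] : set (planeR R)).
Proof. exact: measurableX. Qed.

Lemma measurable_origin : measurable [set (((0, 0), 0) : spaceR R)].
Proof. by rewrite set1_originE; exact: measurableX. Qed.

Lemma leb3_origin : leb3 [set (((0, 0), 0) : spaceR R)] = 0%E.
Proof.
rewrite set1_originE /leb3 (product_measure1E leb2 leb1 m00 m0) /=.
by rewrite lebesgue_measure_set1 mule0.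
Qed.

Lemma bool_descent (P : nat -> bool) i j : (i <= j)%N -> P i -> ~~ P j ->
  exists k, [/\ (i <= k < j)%N, P k & ~~ P k.+1].
Proof.
elim: j => [|j IH] ij Pi Pj.
  by move: ij; rewrite leqn0 => /eqP i0; move: Pj; rewrite -i0 Pi.
move: ij; rewrite leq_eqVlt => /predU1P[ij|]; first by rewrite -ij Pi in Pj.
rewrite ltnS => ij; case: (boolP (P j)) => [Pj'|/(IH ij Pi)[k [/andP[ik kj] Pk Pk1]]].
  by exists j; rewrite ij ltnSn.
by exists k; rewrite ik (leq_trans kj).
Qed.

Lemma cyclic_descent (P : nat -> bool) N i j : P 0%N = P N ->
  (i <= N)%N -> (j <= N)%N -> P i -> ~~ P j ->
  exists k, [/\ (k < N)%N, P k & ~~ P k.+1].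
Proof.
move=> P0N iN jN Pi Pj.
have sub k l : (k <= l <= N)%N -> P k -> ~~ P l ->
    exists m, [/\ (m < N)%N, P m & ~~ P m.+1].
  move=> /andP[kl lN] Pk Pl; have [m [/andP[_ ml] Pm Pm1]] := bool_descent kl Pk Pl.
  by exists m; rewrite (leq_trans ml).
have [ij|ji] := leqP i j; first by apply: (sub i j); rewrite ?ij.
case: (boolP (P N)) => [PN|/(sub i N)]; last by apply; rewrite ?iN/=.
by apply: (sub 0%N j); rewrite ?P0N.
Qed.

(** Going around the polygon, the cap moves from a vertex where it contains x to
    one where it does not, so along some edge x is left behind. *)
Lemma ball_lune_cover c (u : nat -> spaceR R) N : u 0%N = u N ->
  (forall x, 0 < ip x x -> exists2 i, (i <= N)%N & c * len x <= ip x (u i)) ->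
  (forall x, 0 < ip x x -> exists2 j, (j <= N)%N & ip x (u j) < c * len x) ->
  (leb3 (@ball3 R) <= \sum_(k < N) leb3 (lune c (u k) (u k.+1)))%E.
Proof.
move=> u0N hi lo.
(* The origin, where no cap is defined, is covered by a null set. *)
pose F k := if (k < N)%N then lune c (u k) (u k.+1) else [set ((0, 0), 0)].
have mF k : measurable (F k).
  rewrite /F; case: ifPn => _; first exact: measurable_lune.
  exact: measurable_origin.
apply: (@le_trans _ _ (\sum_(k < N.+1) leb3 (F k))%E).
  apply: (content_subadditive leb3 (fun k _ => mF k) (@measurable_ball3 R)).
  move=> x x1; rewrite -bigcup_mkord.
  have := ip_ge0 x; rewrite le_eqVlt => /predU1P[/esym x0|x0].
    exists N => //=; rewrite /F ltnn.
    case: x x0 {x1} => -[a b] d; rewrite /ip /= => x0.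
    by congr (((_, _), _)); nra.
  have [i iN hix] := hi _ x0; have [j jN lojx] := lo _ x0.
  have [//||k [kN kx k1x]] := @cyclic_descent (fun k => c * len x <= ip x (u k)) N i j _ iN jN hix.
  - by rewrite u0N.
  - by rewrite -ltNge.
  by exists k => //=; [rewrite ltnS ltnW|rewrite /F kN; split => //; rewrite ltNge].
rewrite big_ord_recr /= {2}/F ltnn [X in (_ + X)%E]leb3_origin adde0.
by apply: lee_sum => i _; rewrite /F ltn_ord.
Qed.

(** The lunes of the edges cover the ball, so their volumes add up to at least
    the volume of the ball, which cancels. *)
Lemma closed_polygon_arc_length c s al (u : nat -> spaceR R) N :
  0 <= c -> 0 < s -> c ^+ 2 + s ^+ 2 = 1 ->
  u 0%N = u N -> (forall i, (i <= N)%N -> ip (u i) (u i) = 1) ->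
  (forall i, (i < N)%N -> acos (ip (u i) (u i.+1)) <= al) ->
  (forall x, 0 < ip x x -> exists2 i, (i <= N)%N & c * len x <= ip x (u i)) ->
  (forall x, 0 < ip x x -> exists2 j, (j <= N)%N & ip x (u j) < c * len x) ->
  2 * pi - 2 * al <= s * \sum_(i < N) acos (ip (u i) (u i.+1)).
Proof.
move=> c0 s0 cs u0N u1 ual hi lo.
have V0 : 0 < fine (leb3 (@ball3 R)).
  by rewrite fine_gt0// leb3_ball3_gt0 -ge0_fin_numE ?measure_ge0 ?leb3_ball3_fin_num.
have := ball_lune_cover u0N hi lo.
rewrite (eq_bigr (fun i : 'I_N => (fine (leb3 (lune c (u i) (u i.+1))))%:E)); last first.
  by move=> i _; rewrite fineK// leb3_lune_fin_num.
rewrite sumEFin -(fineK (leb3_ball3_fin_num R)) lee_fin => Vle.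
have [al_pi|al_pi] := leP pi al.
  apply: (@le_trans _ _ 0); first by rewrite subr_le0 ler_pM2l.
  apply: mulr_ge0; first exact: ltW.
  by apply: sumr_ge0 => i _; rewrite acos_ge0// ip_cauchy// u1// ltnW.
rewrite -(ler_pM2r V0).
apply: le_trans (_ : _ <= (2 * pi - 2 * al) * _) _.
  by apply: (ler_wpM2l _ Vle); rewrite subr_ge0 ler_pM2l// ltW.
rewrite mulr_sumr [in leRHS]mulrAC mulr_sumr ler_sum// => i _.
have ui : ip (u i) (u i) = 1 by rewrite u1// ltnW.
have uS : ip (u i.+1) (u i.+1) = 1 by rewrite u1.
rewrite [leRHS]mulrC; apply: le_trans (leb3_lune_le c0 s0 cs ui uS).
rewrite ler_wpM2r ?fine_ge0 ?measure_ge0//.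
by rewrite lerB// ler_pM2l// ual.
Qed.

End polygon.

(** * Chords and arcs *)

Section chords_and_arcs.
Variable R : realType.
Implicit Types (x u v w : spaceR R).

Definition chord u v : R :=
  Num.sqrt ((u.1.1 - v.1.1) ^+ 2 + (u.1.2 - v.1.2) ^+ 2 + (u.2 - v.2) ^+ 2).

Definition arc u v : R := acos (ip u v).

Lemma ipC u v : ip u v = ip v u.
Proof. by rewrite /ip; ring. Qed.

Lemma chord_ge0 u v : 0 <= chord u v.
Proof. exact: sqrtr_ge0. Qed.

Lemma chordC u v : chord u v = chord v u.
Proof. by rewrite /chord; congr Num.sqrt; ring. Qed.

Lemma arcC u v : arc u v = arc v u.
Proof. by rewrite /arc ipC. Qed.

Lemma arc_ge0 u v : ip u u = 1 -> ip v v = 1 -> 0 <= arc u v.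
Proof. by move=> u1 v1; apply: acos_ge0; exact: ip_cauchy. Qed.

Lemma arc_lepi u v : ip u u = 1 -> ip v v = 1 -> arc u v <= pi.
Proof. by move=> u1 v1; apply: acos_lepi; exact: ip_cauchy. Qed.

Lemma cos_arc u v : ip u u = 1 -> ip v v = 1 -> cos (arc u v) = ip u v.
Proof. by move=> u1 v1; apply: acosK; rewrite in_itv/=; exact: ip_cauchy. Qed.

Lemma le_cos (a b : R) : 0 <= a -> b <= pi -> a <= b -> cos b <= cos a.
Proof.
move=> a0 bpi ab; rewrite leNgt ltr_cos ?in_itv/= ?a0 ?bpi ?(le_trans a0)//.
  by rewrite -leNgt.
exact: le_trans bpi.
Qed.

Lemma ip_chord_le x u v : ip x u - ip x v <= len x * chord u v.
Proof.
have [d0|d0] := leP (ip x u - ip x v) 0.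
  by rewrite (le_trans d0)// mulr_ge0// ?len_ge0 ?chord_ge0.
rewrite -ler_sqr ?nnegrE ?mulr_ge0 ?len_ge0 ?chord_ge0 ?(ltW d0)//.
rewrite exprMn sqr_len sqr_sqrtr ?addr_ge0 ?sqr_ge0// /ip.
case: x {d0} => -[x1 x2] x3; case: u => -[u1 u2] u3; case: v => -[v1 v2] v3 /=.
have h1 := sqr_ge0 (x1 * (u2 - v2) - x2 * (u1 - v1)).
have h2 := sqr_ge0 (x1 * (u3 - v3) - x3 * (u1 - v1)).
have h3 := sqr_ge0 (x2 * (u3 - v3) - x3 * (u2 - v2)).
rewrite -subr_ge0 (le_trans (addr_ge0 (addr_ge0 h1 h2) h3))// le_eqVlt.
by apply/orP; left; apply/eqP; ring.
Qed.

Lemma chordE u v : ip u u = 1 -> ip v v = 1 -> chord u v = 2 * sin (arc u v / 2).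
Proof.
move=> u1 v1; have a0 := arc_ge0 u1 v1; have api := arc_lepi u1 v1.
have s0 : 0 <= sin (arc u v / 2).
  by apply: sin_ge0_pi; apply/andP; split; lra.
rewrite -[RHS]ger0_norm ?mulr_ge0// -sqrtr_sqr; congr Num.sqrt.
have -> : (2 * sin (arc u v / 2)) ^+ 2 = 2 - 2 * cos (arc u v).
  rewrite [in RHS](_ : arc u v = arc u v / 2 + arc u v / 2); last by field.
  by rewrite cosD -!expr2 cos2sin2; ring.
rewrite cos_arc//; transitivity (ip u u + ip v v - 2 * ip u v).
  by rewrite /ip; ring.
by rewrite u1 v1; ring.
Qed.

Lemma mul_cos_le_sin (y : R) : 0 <= y <= pi / 2 -> y * cos y <= sin y.
Proof.
move=> /andP[]; rewrite le_eqVlt => /predU1P[<-|y0] ypi.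
  by rewrite mul0r sin0.
have pi0 := @pi_gt0 R.
have [|z] := @MVT R sin cos 0 y y0 (fun z _ => is_derive_sin z).
  by apply: continuous_subspaceT => z; exact: continuous_sin.
rewrite in_itv/= => /andP[z0 zy].
rewrite sin0 !subr0 => ->; rewrite mulrC ler_wpM2r ?(ltW y0)//.
by apply: le_cos; [exact: ltW| |exact: ltW]; lra.
Qed.

(** Short arcs are comparable to their chords, with a ratio that tends to 1 as
    eta tends to 0. *)
Lemma small_chord_arc (eta : R) u v : 0 < eta < pi ->
  ip u u = 1 -> ip v v = 1 -> chord u v < 2 * sin (eta / 2) ->
  arc u v <= eta /\ arc u v * cos (eta / 2) <= chord u v.
Proof.
move=> /andP[e0 epi] u1 v1; rewrite chordE// ltr_pM2l//.
have a0 := arc_ge0 u1 v1; have api := arc_lepi u1 v1.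
have pi0 := @pi_gt0 R.
rewrite ltr_sin ?in_itv/=; [|by apply/andP; split; lra..] => ae.
split; first by lra.
apply: (@le_trans _ _ (2 * (arc u v / 2 * cos (arc u v / 2)))).
  rewrite mulrA [2 * _]mulrC mulfVK ?pnatr_eq0//.
  by apply: ler_wpM2l => //; apply: le_cos; lra.
by rewrite ler_pM2l//; apply: mul_cos_le_sin; apply/andP; split; lra.
Qed.

(** The cosine form cos (a + b) <= <u, w> of the inequality follows from the
    nonnegativity of the Gram determinant of u, v, w, which is the square of
    their determinant. *)
Lemma arc_triangle u v w : ip u u = 1 -> ip v v = 1 -> ip w w = 1 ->
  arc u w <= arc u v + arc v w.
Proof.
move=> u1 v1 w1.
have uv0 := arc_ge0 u1 v1; have vw0 := arc_ge0 v1 w1; have uw0 := arc_ge0 u1 w1.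
have uvp := arc_lepi u1 v1; have vwp := arc_lepi v1 w1; have uwp := arc_lepi u1 w1.
have [big|small] := leP pi (arc u v + arc v w); first exact: le_trans big.
rewrite leNgt; apply/negP => lt_arc.
have : cos (arc u w) < cos (arc u v + arc v w).
  by rewrite ltr_cos ?in_itv//= ?uw0 ?uwp// addr_ge0//= ltW.
apply/negP; rewrite -leNgt cosD !cos_arc//.
rewrite /arc !sin_acos ?ip_cauchy//.
set a := ip u v; set b := ip v w; set c := ip u w.
have a1 : 0 <= 1 - a ^+ 2.
  by have /andP[] := ip_cauchy u1 v1; rewrite -/a => ? ?; nra.
have b1 : 0 <= 1 - b ^+ 2.
  by have /andP[] := ip_cauchy v1 w1; rewrite -/b => ? ?; nra.
have gram : 0 <= 1 - a ^+ 2 - b ^+ 2 - c ^+ 2 + 2 * a * b * c.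
  rewrite [leRHS](_ : _ = (u.1.1 * (v.1.2 * w.2 - v.2 * w.1.2)
    - u.1.2 * (v.1.1 * w.2 - v.2 * w.1.1)
    + u.2 * (v.1.1 * w.1.2 - v.1.2 * w.1.1)) ^+ 2) ?sqr_ge0//.
  have -> : 1 - a ^+ 2 - b ^+ 2 - c ^+ 2 + 2 * a * b * c =
    ip u u * ip v v * ip w w - ip w w * a ^+ 2 - ip u u * b ^+ 2
    - ip v v * c ^+ 2 + 2 * a * b * c by rewrite u1 v1 w1; ring.
  by rewrite /a /b /c /ip; ring.
rewrite -sqrtrM// lerBlDr -lerBlDl.
apply: le_trans (ler_norm _) _; rewrite -sqrtr_sqr ler_sqrt ?mulr_ge0//.
by nra.
Qed.

Lemma arc_polygon (u : nat -> spaceR R) i j : (i <= j)%N ->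
  (forall k, (k <= j)%N -> ip (u k) (u k) = 1) ->
  arc (u i) (u j) <= \sum_(i <= k < j) arc (u k) (u k.+1).
Proof.
elim: j => [|j IH] ij u1.
  move: ij u1; rewrite leqn0 => /eqP -> u1.
  by rewrite big_geq// /arc u1// acos1.
move: ij; rewrite leq_eqVlt => /predU1P[->|].
  by rewrite big_geq// /arc u1// acos1.
rewrite ltnS => ij; rewrite big_nat_recr//=.
apply: le_trans (arc_triangle _ (_ : ip (u j) (u j) = 1) _) _; rewrite ?u1//.
  exact: leqW.
by rewrite lerD2r; apply: IH => // k kj; rewrite u1// leqW.
Qed.

Lemma ge_right_limit (f : R -> R) (a b M : R) : a < b -> {for a, continuous f} ->
  (forall t, a < t < b -> M <= f t) -> M <= f a.
Proof.
move=> ab fa Mf; rewrite leNgt; apply/negP => faM.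
have d0 : 0 < M - f a by rewrite subr_gt0.
move/cvgrPdist_lt : fa => /(_ _ d0) /nbhs_ballP[e /= e0 fe].
pose t := a + Num.min (e / 2) ((b - a) / 2).
have [m1 m2] : Num.min (e / 2) ((b - a) / 2) <= e / 2 /\
    Num.min (e / 2) ((b - a) / 2) <= (b - a) / 2.
  by rewrite !ge_min !lexx orbT.
have m0 : 0 < Num.min (e / 2) ((b - a) / 2).
  by rewrite lt_min !divr_gt0// subr_gt0.
have Mt : M <= f t by apply: Mf; rewrite /t; apply/andP; split; lra.
have : ball a e t.
  rewrite /ball /= /t opprD addNKr normrN gtr0_norm//.
  by apply: le_lt_trans m1 _; lra.
by move=> /fe /=; rewrite distrC ltr_norml => /andP[_]; rewrite ltrD2r ltNge Mt.
Qed.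

End chords_and_arcs.

(** * Loops on the sphere *)

Section spherical_loops.
Variable R : realType.
Implicit Types (x u v w : spaceR R) (L eta theta d s t : R).

(** The properties of a rectifiable closed curve used below: uniform continuity
    and a bound L on the lengths of its inscribed polygons with equally spaced
    parameters. *)
Definition loop_on_sphere (gam : R -> spaceR R) L : Prop :=
  [/\ gam 0 = gam 1,
      forall t : R, 0 <= t <= 1 -> ip (gam t) (gam t) = 1,
      forall d : R, 0 < d -> exists N : nat, forall s t : R, 0 <= s <= 1 -> 0 <= t <= 1 ->
        `|s - t| <= N.+1%:R^-1 -> chord (gam s) (gam t) < d
    & forall N : nat,
        \sum_(i < N.+1) chord (gam (i%:R / N.+1%:R)) (gam (i.+1%:R / N.+1%:R)) <= L].

(** The passage from loops to polygons: an inscribed polygon with edges at most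
    eta, with arc length at most L / cos (eta / 2), and as close to the loop as
    prescribed. *)
Lemma fine_polygon gam L eta d : loop_on_sphere gam L -> 0 < eta < pi -> 0 < d ->
  exists N (u : nat -> spaceR R),
  [/\ u 0%N = u N, forall i, (i <= N)%N -> ip (u i) (u i) = 1,
      forall i, (i < N)%N -> arc (u i) (u i.+1) <= eta,
      (\sum_(i < N) arc (u i) (u i.+1)) * cos (eta / 2) <= L
    & forall t, 0 <= t <= 1 -> exists2 i, (i <= N)%N & chord (gam t) (u i) < d].
Proof.
move=> [g01 g1 gunif gL] eta_pi d0.
have s0 : 0 < 2 * sin (eta / 2).
  by move/andP: eta_pi => [? ?]; rewrite mulr_gt0// sin_gt0_pi//; apply/andP; split; lra.
have d'0 : 0 < Num.min d (2 * sin (eta / 2)) by rewrite lt_min d0.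
have [N HN] := gunif _ d'0.
pose u i := gam (i%:R / N.+1%:R); exists N.+1, u.
have N0 : 0 < N.+1%:R :> R by [].
have iN01 i : (i <= N.+1)%N -> 0 <= (i%:R / N.+1%:R : R) <= 1.
  by move=> iN; rewrite divr_ge0//= ler_pdivrMr// mul1r ler_nat.
have u1 i : (i <= N.+1)%N -> ip (u i) (u i) = 1 by move=> iN; rewrite g1// iN01.
have step i : (i < N.+1)%N ->
    arc (u i) (u i.+1) <= eta /\ arc (u i) (u i.+1) * cos (eta / 2) <= chord (u i) (u i.+1).
  move=> iN; apply: small_chord_arc => //; [by rewrite u1// ltnW|exact: u1|].
  have := HN _ _ (iN01 _ (ltnW iN)) (iN01 _ iN).
  rewrite -mulrBl -natr1 opprD addNKr mulN1r normrN gtr0_norm ?invr_gt0//.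
  by rewrite natr1 lexx => /(_ isT); rewrite lt_min => /andP[].
split=> //.
- by rewrite /u mul0r divff// gt_eqF.
- by move=> i iN; have [] := step i iN.
- apply: le_trans (gL N); rewrite mulr_suml; apply: ler_sum => i _.
  by have [] := step i (ltn_ord i).
- move=> t /andP[t0 t1].
  have := @truncn_itv R (t * N.+1%:R); rewrite mulr_ge0// => /(_ isT).
  set i := Num.truncn _ => /andP[i1 i2].
  have iN : (i <= N.+1)%N.
    by rewrite -(ler_nat R) (le_trans i1)// ler_piMl.
  exists i => //; have := HN t (i%:R / N.+1%:R) ltac:(by rewrite t0) (iN01 _ iN).
  have -> : `|t - i%:R / N.+1%:R| <= N.+1%:R^-1.
    rewrite ger0_norm ?subr_ge0 ?ler_pdivrMr// lerBlDl -[X in _ + X]mul1r -mulrDl.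
    by rewrite ler_pdivlMr// natr1 ltW.
  by move=> /(_ isT); rewrite lt_min => /andP[].
Qed.

Definition scl (a : R) x : spaceR R := ((a * x.1.1, a * x.1.2), a * x.2).

Lemma ip_scl a x u : ip (scl a x) u = a * ip x u.
Proof. by rewrite /ip /scl /=; ring. Qed.

Lemma ip_scl2 a x : ip (scl a x) (scl a x) = a ^+ 2 * ip x x.
Proof. by rewrite /ip /scl /=; ring. Qed.

Lemma ip_eq0l x u : ip x x = 0 -> ip x u = 0.
Proof.
case: x => -[a b] c; rewrite /ip /= => x0.
have [-> -> ->] : [/\ a = 0, b = 0 & c = 0] by split; nra.
by rewrite !mul0r !addr0.
Qed.

Lemma len_gt0 x : 0 < ip x x -> 0 < len x.
Proof. by rewrite /len sqrtr_gt0. Qed.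

Lemma unit_scl x : 0 < ip x x -> ip (scl (len x)^-1 x) (scl (len x)^-1 x) = 1.
Proof.
by move=> x0; rewrite ip_scl2 exprVn sqr_len mulVf// gt_eqF.
Qed.

Lemma unit_sclN x : 0 < ip x x -> ip (scl (- (len x)^-1) x) (scl (- (len x)^-1) x) = 1.
Proof. by move=> x0; rewrite ip_scl2 sqrrN -ip_scl2 unit_scl. Qed.

Lemma cos_half_continuous (a b : R) : {for 0, continuous (fun t : R => (a - b * t) * cos (t / 2))}.
Proof.
apply: (@continuousM _ _ (fun t : R => a - b * t) (fun t => cos (t / 2))).
  apply: continuousB; first exact: cvg_cst.
  by apply: continuousM; [exact: cvg_cst|exact: cvg_id].
apply: continuous_comp; last exact: continuous_cos.
by apply: continuousM; [exact: cvg_id|exact: cvg_cst].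
Qed.

Lemma cos_half_limit (a b M : R) :
  (forall eta, 0 < eta < pi -> (a - b * eta) * cos (eta / 2) <= M) -> a <= M.
Proof.
move=> aM; rewrite -lerN2.
have -> : - a = - ((a - b * 0) * cos (0 / 2)) by rewrite mul0r cos0 mulr0 subr0 mulr1.
apply: (@ge_right_limit _ (fun t => - ((a - b * t) * cos (t / 2))) _ pi _ (@pi_gt0 R)).
  by apply: continuousN; exact: cos_half_continuous.
by move=> t t0; rewrite lerN2 aM.
Qed.

(** Every x has a point of the loop within theta, and so has -x; as theta' < pi/2
    exceeds theta, a fine enough polygon has a vertex whose cap of radius theta'
    contains x, and another one whose cap does not. *)
Lemma loop_cover_length gam L theta theta' : loop_on_sphere gam L ->
  0 <= theta -> theta < theta' -> theta' < pi / 2 ->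
  (forall x, ip x x = 1 -> exists2 t, 0 <= t <= 1 & cos theta <= ip x (gam t)) ->
  2 * pi <= sin theta' * L.
Proof.
move=> gam_loop t0 tt' t'pi cover.
have pi0 := @pi_gt0 R.
have s0 : 0 < sin theta' by rewrite sin_gt0_pi//; apply/andP; split; lra.
have c0 : 0 < cos theta' by rewrite cos_gt0_pihalf//; apply/andP; split; lra.
have cc : cos theta' < cos theta.
  by rewrite ltr_cos// in_itv/=; apply/andP; split; lra.
apply: (@cos_half_limit _ 2) => eta eta_pi.
have d0 : 0 < cos theta - cos theta' by rewrite subr_gt0.
have [N [u [u0N u1 ueta uL near_u]]] := fine_polygon gam_loop eta_pi d0.
have ce0 : 0 <= cos (eta / 2).
  by move/andP: eta_pi => [? ?]; apply: cos_ge0_pihalf; apply/andP; split; lra.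
apply: (@le_trans _ _ (sin theta' * (\sum_(i < N) arc (u i) (u i.+1)) * cos (eta / 2))); last first.
  by rewrite -mulrA ler_pM2l.
apply: (ler_wpM2r ce0).
apply: (@closed_polygon_arc_length _ (cos theta')) => //; first exact: ltW.
- exact: cos2Dsin2.
- move=> x x0; have lx := len_gt0 x0.
  have [t t01] := cover _ (unit_scl x0).
  rewrite ip_scl ler_pdivlMl// mulrC => ct.
  have [i iN ui] := near_u t t01; exists i => //.
  have := ip_chord_le x (gam t) (u i); move: ui; set ch := chord _ _ => ui.
  have : len x * ch <= len x * (cos theta - cos theta') by rewrite ler_pM2l// ltW.
  by rewrite mulrBr; move: ct; lra.
- move=> x x0; have lx := len_gt0 x0.
  have [t t01] := cover _ (unit_sclN x0).
  rewrite ip_scl mulNr lerNr ler_pdivrMl// mulrN => ct.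
  have [i iN ui] := near_u t t01; exists i => //.
  have := ip_chord_le x (u i) (gam t); move: ui; rewrite chordC; set ch := chord _ _ => ui.
  have : len x * ch <= len x * (cos theta - cos theta') by rewrite ler_pM2l// ltW.
  have : 0 < len x * cos theta' by rewrite mulr_gt0.
  by rewrite mulrBr [cos theta' * _]mulrC; move: ct; lra.
Qed.

Lemma cos_add_ge (A B M : R) : 0 <= A -> 0 <= B -> A + B <= M -> M < pi ->
  2 * cos (M / 2) ^+ 2 <= cos A + cos B.
Proof.
move=> A0 B0 ABM Mpi; have pi0 := @pi_gt0 R.
have -> : cos A + cos B = 2 * (cos ((A + B) / 2) * cos ((A - B) / 2)).
  rewrite [in LHS](_ : A = (A + B) / 2 + (A - B) / 2); last by field.
  rewrite [in X in _ + cos X](_ : B = (A + B) / 2 - (A - B) / 2); last by field.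
  by rewrite cosB cosD; ring.
have c0 : 0 <= cos (M / 2) by apply: cos_ge0_pihalf; apply/andP; split; lra.
rewrite ler_pM2l// expr2; apply: ler_pM => //; first by apply: le_cos; lra.
rewrite -(cos_norm ((A - B) / 2)); apply: le_cos => //; first by lra.
by rewrite ler_norml; apply/andP; split; lra.
Qed.

(** A loop shorter than 2 pi lies in an open hemisphere. Take vertices p and q
    that halve the length: every point z of the loop has arcs to p and to q of
    sum less than pi, hence <z, p> + <z, q> > 0, uniformly in z, and the
    antipode of the midpoint of p and q is farther than pi/2 from the loop. *)
Lemma loop_hemisphere_length gam L : loop_on_sphere gam L ->
  (forall x e, ip x x = 1 -> 0 < e ->
     exists2 t, 0 <= t <= 1 & - e < ip x (gam t)) ->
  2 * pi <= L.
Proof.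
move=> gam_loop cover; have pi0 := @pi_gt0 R.
have [_ gam1 _ _] := gam_loop.
apply: (@cos_half_limit _ 6) => eta eta_pi; rewrite leNgt; apply/negP => Llt.
have /andP[eta0 etapi] := eta_pi.
have ce0 : 0 < cos (eta / 2).
  by apply: cos_gt0_pihalf; apply/andP; split; lra.
have d0 : 0 < 2 * sin (eta / 2).
  by rewrite mulr_gt0// sin_gt0_pi//; apply/andP; split; lra.
have [N [u [u0N u1 ueta uL near_u]]] := fine_polygon gam_loop eta_pi d0.
pose a k := arc (u k) (u k.+1).
pose S k := \sum_(0 <= i < k) a i.
have SN : S N < 2 * pi - 6 * eta.
  by rewrite -(ltr_pM2r ce0) /S big_mkord; exact: le_lt_trans uL Llt.
have a0 k : (k < N)%N -> 0 <= a k by move=> kN; rewrite arc_ge0// u1// ltnW.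
have SN0 : 0 <= S N.
  by rewrite /S big_mkord; apply: sumr_ge0 => i _; exact: a0.
have exk : exists k, S N <= 2 * S k by exists N; lra.
(* The vertex k is the first one at or beyond half of the length. *)
pose k := ex_minn exk.
have kP : S N <= 2 * S k by rewrite /k; case: ex_minnP.
have kmin m : S N <= 2 * S m -> (k <= m)%N by rewrite /k; case: ex_minnP => ? ? h /h.
have kN : (k <= N)%N by apply: kmin; lra.
have Sk : 2 * S k <= S N + 2 * eta.
  case: (posnP k) => [->|k0]; first by rewrite [S 0%N]big_geq// mulr0; lra.
  have : 2 * S k.-1 < S N.
    by rewrite ltNge; apply/negP => /kmin; rewrite -{1}(prednK k0) ltnn.
  have -> : S k = S k.-1 + a k.-1 by rewrite -{1}(prednK k0) /S big_nat_recr.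
  have : a k.-1 <= eta by apply: ueta; rewrite prednK.
  by lra.
pose M := S N / 2 + 3 * eta.
have Mpi : M < pi by rewrite /M; lra.
have far t : 0 <= t <= 1 -> arc (gam t) (u 0%N) + arc (gam t) (u k) <= M.
  move=> t01; have [j jN cj] := near_u t t01.
  have [atj _] := small_chord_arc eta_pi (gam1 t t01) (u1 j jN) cj.
  have := arc_triangle (gam1 t t01) (u1 j jN) (u1 0%N (leq0n _)).
  have := arc_triangle (gam1 t t01) (u1 j jN) (u1 k kN).
  suff : arc (u j) (u 0%N) + arc (u j) (u k) <= S N / 2 + eta by rewrite /M; lra.
  have [jk|/ltnW kj] := leqP j k.
    have h1 : arc (u 0%N) (u j) <= S j.
      by apply: arc_polygon => // i ij; rewrite u1// (leq_trans ij).
    have h2 : arc (u j) (u k) <= \sum_(j <= i < k) a i.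
      by apply: arc_polygon => // i ik; rewrite u1// (leq_trans ik).
    have : S k = S j + \sum_(j <= i < k) a i by rewrite /S -big_cat_nat.
    by rewrite arcC; move: h1 h2 Sk; lra.
  have h1 : arc (u j) (u N) <= \sum_(j <= i < N) a i by apply: arc_polygon.
  have h2 : arc (u k) (u j) <= \sum_(k <= i < j) a i.
    by apply: arc_polygon => // i ij; rewrite u1// (leq_trans ij).
  have : S N = S k + (\sum_(k <= i < j) a i + \sum_(j <= i < N) a i).
    by rewrite /S -!big_cat_nat.
  by rewrite u0N [arc (u j) (u k)]arcC; move: h1 h2 kP; lra.
pose w : spaceR R := (((u 0%N).1.1 + (u k).1.1, (u 0%N).1.2 + (u k).1.2), (u 0%N).2 + (u k).2).
have ipw x : ip w x = ip x (u 0%N) + ip x (u k) by rewrite /ip /w /=; ring.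
pose kap := 2 * cos (M / 2) ^+ 2.
have M0 : 0 <= M by rewrite /M; lra.
have kap0 : 0 < kap.
  by rewrite mulr_gt0// exprn_gt0// cos_gt0_pihalf//; apply/andP; split; lra.
have wkap t : 0 <= t <= 1 -> kap <= ip w (gam t).
  move=> t01; rewrite ipw -(cos_arc (gam1 t t01) (u1 0%N (leq0n N))).
  rewrite -(cos_arc (gam1 t t01) (u1 k kN)).
  by apply: cos_add_ge (far t t01) Mpi; rewrite arc_ge0 ?gam1 ?u1.
have w0 : 0 < ip w w.
  rewrite lt_neqAle ip_ge0 andbT eq_sym; apply/eqP => w0.
  have := wkap 0; rewrite lexx ler01 => /(_ isT).
  by rewrite ip_eq0l// leNgt kap0.
have lw := len_gt0 w0.
have [|t t01] := cover _ (kap / len w) (unit_sclN w0); first by rewrite divr_gt0.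
rewrite ip_scl mulNr ltrN2 mulrC ltr_pM2r ?invr_gt0//.
by rewrite ltNge wkap.
Qed.

End spherical_loops.

(** * Curves of row vectors *)

Section row_vectors.
Variable R : realType.
Implicit Types (u v : 'rV[R]_3) (g : R -> 'rV[R]_3).

Definition coords u : spaceR R := ((u 0 0, u 0 1), u 0 2).

Definition of_coords (x : spaceR R) : 'rV[R]_3 :=
  \row_j (if j == 0 then x.1.1 else if j == 1 then x.1.2 else x.2).

Lemma of_coordsK x : coords (of_coords x) = x.
Proof. by case: x => -[a b] c; rewrite /coords !mxE. Qed.

Lemma dotpE u v : dotp u v = ip (coords u) (coords v).
Proof.
rewrite /dotp mxE !big_ord_recr big_ord0 /= add0r !mxE /ip /coords /=.
by congr (u 0 _ * v 0 _ + u 0 _ * v 0 _ + u 0 _ * v 0 _); apply/val_inj.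
Qed.

Lemma enormB u v : enorm (u - v) = chord (coords u) (coords v).
Proof.
by rewrite /enorm dotpE /chord /ip /coords /= !mxE -!expr2.
Qed.

Lemma sphere2E u : sphere2 R u -> ip (coords u) (coords u) = 1.
Proof.
rewrite /sphere2 /= /enorm dotpE => u1.
by rewrite -[LHS]sqr_sqrtr ?ip_ge0// u1 expr1n.
Qed.

Lemma sphere2_of_coords x : ip x x = 1 -> sphere2 R (of_coords x).
Proof. by move=> x1; rewrite /sphere2 /= /enorm dotpE of_coordsK x1 sqrtr1. Qed.

Lemma coord_le_norm u i : `|u 0 i| <= `|u|.
Proof.
by rewrite [leRHS]/Num.norm /= mx_normrE; apply/bigmax_geP; right => /=; exists (0, i).
Qed.

Lemma chord_le_norm u v : chord (coords u) (coords v) <= 2 * `|u - v|.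
Proof.
have cn i : (u 0 i - v 0 i) ^+ 2 <= `|u - v| ^+ 2.
  have := coord_le_norm (u - v) i; rewrite !mxE => h.
  by rewrite -real_normK ?num_real// ler_sqr ?nnegrE.
rewrite -ler_sqr ?nnegrE ?mulr_ge0 ?chord_ge0 ?normr_ge0//.
rewrite sqr_sqrtr ?addr_ge0 ?sqr_ge0// /coords /= exprMn.
have := cn 0; have := cn 1; have := cn 2; have := sqr_ge0 `|u - v|.
by lra.
Qed.

Lemma chord_uniform_continuity g d : {within `[0, 1], continuous g} -> 0 < d ->
  exists N : nat, forall s t : R, 0 <= s <= 1 -> 0 <= t <= 1 ->
    `|s - t| <= N.+1%:R^-1 -> chord (coords (g s)) (coords (g t)) < d.
Proof.
move=> /subspace_continuousP gc d0.
have e0 : 0 < d / 4 by rewrite divr_gt0.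
pose P (n : nat) (t : R) := 0 <= t <= 1 -> forall s : R, 0 <= s <= 1 ->
  `|s - t| <= n.+1%:R^-1 -> chord (coords (g s)) (coords (g t)) < d.
have : \forall n \near \oo, `[0, 1]%classic `<=` P n.
  apply: (compact_near_coveringP _).1 => [|x]; first exact: segment_compact.
  move=> /gc /cvgrPdist_lt /(_ _ e0); rewrite near_withinE.
  move=> /nbhs_ballP[r /= r0 gr].
  have r20 : 0 < r / 2 by rewrite divr_gt0.
  exists (ball x (r / 2), [set n | n.+1%:R^-1 < r / 2]) => /=.
    split; first exact: nbhsx_ballx.
    exact: (near_infty_natSinv_lt (PosNum r20)).
  move=> [t n] /= [xt nr] t01 s s01 st.
  have gt : `|g x - g t| < d / 4.
    apply: gr; last by rewrite /= in_itv.
    by move: xt; rewrite /ball/=; lra.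
  have gs : `|g x - g s| < d / 4.
    apply: gr; last by rewrite /= in_itv.
    rewrite /ball/= (_ : x - s = (x - t) + - (s - t)); last by ring.
    apply: le_lt_trans (ler_normD _ _) _; rewrite normrN.
    by have := le_lt_trans st nr; move: xt; rewrite /ball/=; lra.
  apply: le_lt_trans (chord_le_norm _ _) _.
  have -> : g s - g t = (g x - g t) - (g x - g s) by rewrite opprB [RHS]addrC subrKA.
  apply: (@le_lt_trans _ _ (2 * (`|g x - g t| + `|g x - g s|))).
    by rewrite ler_pM2l// ler_normB.
  by lra.
move=> [N _ HN]; exists N => s t s01 t01 st.
by apply: (HN N (leqnn N) t); rewrite //= in_itv.
Qed.

Lemma polygon_le_curve_length g (N : nat) : rectifiable g ->
  \sum_(i < N.+1) chord (coords (g (i%:R / N.+1%:R)))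
                        (coords (g (i.+1%:R / N.+1%:R)))
    <= fine (curve_length g).
Proof.
move=> g_rect; pose s := [seq (i.+1%:R / N.+1%:R : R) | i <- iota 0 N.+1].
have N0 : 0 < N.+1%:R :> R by [].
have size_s : size s = N.+1 by rewrite size_map size_iota.
have nth_s b i : (i <= N.+1)%N -> nth b (0 :: s) i = i%:R / N.+1%:R.
  case: i => [_|i iN] /=; first by rewrite mul0r.
  by rewrite (nth_map 0%N) ?size_iota// nth_iota.
have part : itv_partition 0 1 s.
  split.
    apply/(pathP 0) => i; rewrite size_s => iN.
    rewrite nth_s 1?ltnW// -[nth 0 s i]/(nth 0 (0 :: s) i.+1) nth_s//.
    by rewrite ltr_pM2r ?invr_gt0// ltr_nat.
  by rewrite (last_nth 0) size_s nth_s// divff// gt_eqF.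
have -> : \sum_(i < N.+1) chord (coords (g (i%:R / N.+1%:R)))
                (coords (g (i.+1%:R / N.+1%:R))) = polygon_length 0 1 g s.
  rewrite /polygon_length size_s big_mkord; apply: eq_bigr => i _.
  by rewrite enormB chordC /comp !nth_s// ltnW.
have le_len : ((polygon_length 0 1 g s)%:E <= curve_length g)%E.
  by apply: ereal_sup_ubound; exists s.
rewrite -lee_fin fineK// fin_real// g_rect andbT.
exact: lt_le_trans (ltNyr _) le_len.
Qed.

Lemma rectifiable_loop g : simple_closed_curve g -> rectifiable g ->
  trace_of g `<=` sphere2 R ->
  loop_on_sphere (coords \o g) (fine (curve_length g)).
Proof.
move=> [gc g01 _] g_rect gS; split.
- by rewrite /= g01.
- by move=> t t01; apply/sphere2E/gS; exists t => //=; rewrite in_itv.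
- by move=> d d0; exact: chord_uniform_continuity.
- by move=> N; exact: polygon_le_curve_length.
Qed.

Lemma acos_set_has_inf g (x : 'rV[R]_3) : trace_of g `<=` sphere2 R -> sphere2 R x ->
  has_inf [set acos (dotp x y) | y in trace_of g].
Proof.
move=> gS xS; split.
  exists (acos (dotp x (g 0))), (g 0) => //; exists 0 => //=.
  by rewrite in_itv/= lexx ler01.
exists 0 => _ [y /gS yS <-]; rewrite acos_ge0// dotpE ip_cauchy//; exact: sphere2E.
Qed.

Lemma tube_cover g (theta theta1 : R) : trace_of g `<=` sphere2 R ->
  tube theta (trace_of g) = sphere2 R -> theta < theta1 -> 0 <= theta1 <= pi ->
  forall x, ip x x = 1 ->
    exists2 t, 0 <= t <= 1 & cos theta1 < ip x (coords (g t)).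
Proof.
move=> gS tubeS tt1 t1pi x x1.
have xS := sphere2_of_coords x1.
have : tube theta (trace_of g) (of_coords x) by rewrite tubeS.
move=> [_ dx].
have e0 : 0 < theta1 - theta by rewrite subr_gt0.
have [_ [y [t t01 <-] <-]] := inf_adherent e0 (acos_set_has_inf gS xS).
rewrite dotpE of_coordsK => ht; rewrite /= in_itv/= in t01; exists t => //.
have gt1 : ip (coords (g t)) (coords (g t)) = 1.
  by apply/sphere2E/gS; exists t => //=; rewrite in_itv.
have cx := ip_cauchy x1 gt1.
rewrite -[ltRHS]acosK ?in_itv//= ltr_cos ?in_itv//=; last first.
  by rewrite acos_ge0// acos_lepi.
by apply: lt_le_trans ht _; move: dx; rewrite /geodist; lra.
Qed.

(** For theta < pi/2 the radius is first increased to theta' < pi/2, to gain the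
    room that polygonal approximation needs, and then decreased back by
    continuity of the sine. No room is left at pi/2, where the hemisphere
    argument replaces the volume one. *)
Lemma covering_length g (theta : R) : simple_closed_curve g -> rectifiable g ->
  trace_of g `<=` sphere2 R -> 0 < theta <= pi / 2 ->
  tube theta (trace_of g) = sphere2 R ->
  2 * pi <= sin theta * fine (curve_length g).
Proof.
move=> g_simple g_rect gS /andP[t0]; have pi0 := @pi_gt0 R.
have gam_loop := rectifiable_loop g_simple g_rect gS.
rewrite le_eqVlt => /predU1P[->|tpi] tubeS.
  rewrite sin_pihalf mul1r; apply: (loop_hemisphere_length gam_loop) => x e x1 e0.
  pose e' := Num.min e 1.
  have e'0 : 0 < e' by rewrite lt_min e0 ltr01.
  have e'1 : e' <= 1 by rewrite ge_min lexx orbT.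
  have e'e : e' <= e by rewrite ge_min lexx.
  have me' : -1 <= - e' <= 1 by apply/andP; split; lra.
  have t1 : 0 <= acos (- e') <= pi by rewrite acos_ge0// acos_lepi.
  have pi_t1 : pi / 2 < acos (- e').
    rewrite -ltr_cos ?in_itv//=; last by apply/andP; split; lra.
    by rewrite acosK ?in_itv//= cos_pihalf; lra.
  have [t t01] := tube_cover gS tubeS pi_t1 t1 x1.
  rewrite acosK ?in_itv//= => ht; exists t => //.
  by apply: le_lt_trans ht; rewrite lerN2.
apply: (@ge_right_limit _ (fun t => sin t * fine (curve_length g)) _ (pi / 2)) => //.
  apply: (@continuousM _ _ sin (cst (fine (curve_length g)))).
    exact: continuous_sin.
  exact: cvg_cst.
move=> theta' /andP[tt' t'pi].
pose theta1 := (theta + theta') / 2.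
have tt1 : theta < theta1 by rewrite /theta1; lra.
have t1 : 0 <= theta1 <= pi by rewrite /theta1; apply/andP; split; lra.
apply: (@loop_cover_length _ _ _ theta1 theta' gam_loop) => //.
- by case/andP: t1.
- by rewrite /theta1; lra.
move=> x x1; have [t t01 ht] := tube_cover gS tubeS tt1 t1 x1.
by exists t => //; exact: ltW.
Qed.

End row_vectors.

Theorem corollary5 (R : realType) (g : R -> 'rV[R]_3) (C : set 'rV[R]_3) (L : R)
    (g_simple : simple_closed_curve g)
    (g_rect : rectifiable g)
    (C_def : C = trace_of g)
    (C_sphere : C `<=` sphere2 R)
    (L_def : L = fine (curve_length g)) :
  (2 * pi <= L ->
     exists2 vartheta : R,
       unique (fun t : R => 0 < t <= pi / 2 /\ sin t = 2 * pi / L) vartheta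
       & vartheta <= covering_radius C)
  /\
  (forall theta : R, 0 < theta <= pi / 2 ->
     tube theta C = sphere2 R -> 2 * pi / sin theta <= L).
Proof.
subst C L; set L := fine _; have pi0 := @pi_gt0 R.
have sin_pos t : 0 < t <= pi / 2 -> 0 < sin t :> R.
  by move=> /andP[t0 tpi]; apply: sin_gt0_pi; apply/andP; split; lra.
have bound (theta : R) : 0 < theta <= pi / 2 ->
    tube theta (trace_of g) = sphere2 R -> 2 * pi / sin theta <= L.
  move=> tpi tubeS; rewrite ler_pdivrMr ?sin_pos// [leRHS]mulrC.
  exact: covering_length.
split=> // L_ge.
have L0 : 0 < L by apply: lt_le_trans L_ge; rewrite mulr_gt0.
have q0 : 0 < 2 * pi / L by rewrite divr_gt0// mulr_gt0.
have q1 : 2 * pi / L <= 1 by rewrite ler_pdivrMr// mul1r.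
have q11 : -1 <= 2 * pi / L <= 1 by apply/andP; split; lra.
pose v := asin (2 * pi / L).
have sv : sin v = 2 * pi / L by rewrite asinK ?in_itv.
have v_le : v <= pi / 2 by exact: asin_lepi2.
have v_ge : - (pi / 2) <= v by exact: asin_geNpi2.
have v0 : 0 < v.
  have : (sin 0 < sin v) = (0 < v).
    by apply: ltr_sin; rewrite in_itv/=; apply/andP; split; lra.
  by rewrite sin0 sv q0 => <-.
exists v.
  split=> [|t [/andP[t0 tpi] st]]; first by rewrite v0.
  by apply: sin_inj; [..|by rewrite sv st];
    rewrite in_itv/=; apply/andP; split; lra.
rewrite leNgt; apply/negP => rad_v; set rad := covering_radius _ in rad_v.
(* If rad < v, the tube of any radius theta in [rad, v[ is the whole sphere, and
   then L >= 2 pi / sin theta > 2 pi / sin v = L. *)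
have dist_le x : sphere2 R x -> geodist x (trace_of g) <= rad.
  move=> xS; apply: sup_ubound; last by exists x.
  exists pi => _ [y yS <-].
  have [[a [z zg _]] lb] := acos_set_has_inf C_sphere yS.
  apply: (@le_trans _ _ (acos (dotp y z))); first by apply: ge_inf => //; exists z.
  by rewrite acos_lepi// dotpE ip_cauchy//; apply: sphere2E => //; exact: C_sphere.
pose theta := Num.max rad (v / 2).
have [th1 th2] : rad <= theta /\ v / 2 <= theta by rewrite !le_max !lexx orbT.
have th3 : theta < v by rewrite gt_max rad_v/=; lra.
have th_pi : 0 < theta <= pi / 2 by apply/andP; split; lra.
have : 2 * pi / sin theta <= L.
  apply: bound => //; apply/seteqP; split => [x []//|x xS].
  by split=> //; exact: le_trans (dist_le x xS) th1.
rewrite ler_pdivrMr ?sin_pos// -ler_pdivrMl// mulrC -sv leNgt.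
have -> : (sin theta < sin v) = (theta < v).
  by apply: ltr_sin; rewrite in_itv/=; apply/andP; split; lra.
by rewrite th3.
Qed.
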